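(* Let $\mathbb{T}=\{0,1,\ldots,T\}$ with $T<\infty$, and let $V_t^i$ denote the value processes of the finite-horizon optimal switching problem, $$V_t^{i} = \operatorname*{ess\,inf}_{\xi\in\mathcal{U}^i_t}\rho_{t,T}\big(\tilde g_{\xi_{t-1},\xi_t}(t),\ldots,\tilde g_{\xi_{T-1},\xi_{T}}(T)\big),\qquad i\in\mathcal{I},\ t\in\mathbb{T}.$$ Define $\{\hat V_t^{i}: i\in\mathcal{I}, t\in\mathbb{T}\}$ by backward recursion: $$\hat V_T^{i}=\min_{j\in\mathcal{I}} \rho_T(\tilde g_{i,j}(T)),\qquad \hat V_t^{i}=\min_{j\in\mathcal{I}} \rho_t\big(\tilde g_{i,j}(t)+\hat V^{j}_{t+1}\big)\quad\text{for } 0\le t<T .$$ Then $\hat V_t^{i}=V_t^{i}$ for all $i\in\mathcal{I}$ and $t\in\mathbb{T}$. Moreover, starting from any $0\le t\le T$ and $i\in\mathcal{I}$, an optimal strategy $\xi^*\in\mathcal{U}^i_t$ (i.e. one attaining the essential infimum defining $V^i_t$) can be defined by $$\begin{cases}\xi^*_{t-1}=i,\\ \xi^*_s\in\arg\min_{j\in\mathcal{I}}\rho_s\big(\tilde g_{\xi^*_{s-1},j}(s)+\hat V^j_{s+1}\big),& t\le s<T,\\ \xi^*_T\in\arg\min_{j\in\mathcal{I}}\rho_T\big(\tilde g_{\xi^*_{T-1},j}(T)\big),\end{cases}$$ where each $\xi^*_s$ is a $\mathcal{G}_s$-measurable selection from the indicated (random) set of minimisers.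
   Context: $(\Omega,\mathcal{F},\mathbb{P})$ is a probability space and $\mathbb{G}=\{\mathcal{G}_t\}_{t\in\mathbb{T}}$ is a filtration of sub-$\sigma$-algebras of $\mathcal{F}$. $L^\infty_{\mathcal{H}}$ denotes the space of essentially bounded $\mathcal{H}$-measurable random variables. All (in)equalities between random variables are $\mathbb{P}$-almost sure. A $\mathbb{G}$-conditional risk mapping is a family $\rho=\{\rho_t\}_{t\in\mathbb{T}}$, $\rho_t:L^\infty_{\mathcal{F}}\to L^\infty_{\mathcal{G}_t}$, satisfying for all $t$: normalisation $\rho_t(0)=0$; conditional translation invariance $\rho_t(Z+W)=Z+\rho_t(W)$ for $W\in L^\infty_{\mathcal{F}}$, $Z\in L^\infty_{\mathcal{G}_t}$; monotonicity: $W\le Z$ implies $\rho_t(W)\le\rho_t(Z)$ for $W,Z\in L^\infty_{\mathcal F}$. Such a $\rho$ is fixed. The aggregated risk mapping is $\rho_{t,t}(W_t)=\rho_t(W_t)$ and, for $s<t$, $\rho_{s,t}(W_s,\ldots,W_t)=\rho_s\big(W_s+\rho_{s+1}(W_{s+1}+\cdots+\rho_{t-1}(W_{t-1}+\rho_t(W_t))\cdots)\big)$. $\mathcal{I}=\{1,\ldots,m\}$ is a finite set of modes; $g_i(t)$ and $c_{i,j}(t)$ ($i,j\in\mathcal{I}$, $t\in\mathbb{T}$) are random variables in $L^\infty_{\mathcal{F}}$ (not assumed $\mathbb{G}$-adapted) with $c_{i,i}(t)=0$, and $\tilde g_{i,j}(t)=g_j(t)+c_{i,j}(t)$. A strategy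 is an $\mathcal{I}$-valued, $\mathbb{G}$-adapted random sequence $\xi=(\xi_t)_{t\in\{-1\}\cup\mathbb{T}}$ (with $\xi_{-1}$ the initial mode), and $\mathcal{U}^i_t$ is the set of strategies with $\xi_{t-1}=i$. The values of a strategy in $\mathcal{U}^i_t$ before time $t-1$ play no role. For a random $\mathcal{I}$-valued index $\eta$, an expression such as $\rho_s(\tilde g_{\eta,j}(s)+\cdot)$ with $\eta$ $\mathcal{G}_s$-measurable is evaluated as $\sum_{k}\mathbf{1}_{\{\eta=k\}}\rho_s(\tilde g_{k,j}(s)+\cdot)$. *)

(* Defs.v *)
From mathcomp Require Import all_boot all_order all_algebra.
From mathcomp Require Import all_classical all_reals all_analysis measurable_realfun.

Set Implicit Arguments.
Unset Strict Implicit.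
Unset Printing Implicit Defensive.

Import Order.TTheory GRing.Theory Num.Theory.
Import numFieldNormedType.Exports.

Local Open Scope classical_set_scope.
Local Open Scope ring_scope.

(* Random variables are represented by functions rather than by classes modulo
   a.s. equality; every relation between them is stated P-almost surely. *)

Section FiltrationsAndRiskMappings.
Context {R : realType} {d : measure_display} {Omega : measurableType d}.
Variables (P : probability Omega R) (T : nat).
Implicit Types (G : nat -> set (set Omega)) (rho : nat -> (Omega -> R) -> Omega -> R).

(* Only the times 0, ..., T are relevant. *)
Definition is_filtration G : Prop :=
  [/\ forall t, (t <= T)%N -> sigma_algebra setT (G t),
      forall t, (t <= T)%N -> G t `<=` measurable &
      forall s t, (s <= t <= T)%N -> G s `<=` G t].

Definition Linfty : set (Omega -> R) := [set W : Omega -> R | W \in Lfun P +oo%E].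

Definition Linfty_sub (H : set (set Omega)) : set (Omega -> R) :=
  [set W : Omega -> R | Linfty W /\
     measurable_fun [set: g_sigma_algebraType H] (W : g_sigma_algebraType H -> R)].

(* Monotonicity makes [rho t] compatible with a.s. equality, so that it induces
   a map on classes. *)
Record is_cond_risk_mapping G rho : Prop := {
  crm_range : forall t W, (t <= T)%N -> Linfty W -> Linfty_sub (G t) (rho t W);
  crm_normalised : forall t, (t <= T)%N -> rho t (cst 0) = cst 0 %[ae P];
  crm_translation : forall t Z W, (t <= T)%N -> Linfty_sub (G t) Z -> Linfty W ->
    rho t (Z \+ W) = Z \+ rho t W %[ae P];
  crm_monotone : forall t W Z, (t <= T)%N -> Linfty W -> Linfty Z ->
    (\forall w \ae P, W w <= Z w) -> \forall w \ae P, rho t W w <= rho t Z w }.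

Fixpoint agg_risk_steps rho (n s : nat) (W : nat -> Omega -> R) : Omega -> R :=
  if n is n'.+1 then rho s (W s \+ agg_risk_steps rho n' s.+1 W)
  else rho s (W s).

(* rho_{s,t}(W_s, ..., W_t), for s <= t *)
Definition agg_risk rho (s t : nat) (W : nat -> Omega -> R) : Omega -> R :=
  agg_risk_steps rho (t - s) s W.

(* X is a version of the essential infimum of the family F. *)
Definition is_ess_infimum (F : set (Omega -> R)) (X : Omega -> \bar R) : Prop :=
  [/\ measurable_fun setT X,
      forall Y, F Y -> \forall w \ae P, (X w <= (Y w)%:E)%E &
      forall Z : Omega -> \bar R, measurable_fun setT Z ->
        (forall Y, F Y -> \forall w \ae P, (Z w <= (Y w)%:E)%E) ->
        \forall w \ae P, (Z w <= X w)%E].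

Definition ess_infimum (F : set (Omega -> R)) : Omega -> \bar R :=
  xget (cst +oo%E) [set X | is_ess_infimum F X].

End FiltrationsAndRiskMappings.

Section OptimalSwitching.
Context {R : realType} {d : measure_display} {Omega : measurableType d}.
Variables (P : probability Omega R) (T : nat) (G : nat -> set (set Omega)).
Variables (rho : nat -> (Omega -> R) -> Omega -> R) (m : nat).
Variables (g : 'I_m -> nat -> Omega -> R) (c : 'I_m -> 'I_m -> nat -> Omega -> R).

Definition gtilde (i j : 'I_m) (t : nat) : Omega -> R := g j t \+ c i j t.

(* Indices are shifted by one: [xi 0] is the initial mode xi_{-1}, which is
   deterministic, and [xi t.+1] is the mode xi_t chosen at time t. *)
Definition is_strategy (xi : nat -> Omega -> 'I_m) : Prop :=
  (exists i0, xi 0%N = cst i0) /\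
  forall t, (t <= T)%N -> forall k, G t (xi t.+1 @^-1` [set k]).

(* U^i_t, the strategies with xi_{t-1} = i *)
Definition strategies_from (t : nat) (i : 'I_m) : set (nat -> Omega -> 'I_m) :=
  [set xi | is_strategy xi /\ xi t = cst i %[ae P]].

(* s |-> gtilde_{xi_{s-1}, xi_s}(s) *)
Definition switching_cost (xi : nat -> Omega -> 'I_m) (s : nat) : Omega -> R :=
  fun w => gtilde (xi s w) (xi s.+1 w) s w.

Definition strategy_risk (t : nat) (xi : nat -> Omega -> 'I_m) : Omega -> R :=
  agg_risk rho t T (switching_cost xi).

Definition value (t : nat) (i : 'I_m) : Omega -> \bar R :=
  ess_infimum P [set strategy_risk t xi | xi in strategies_from t i].

(* The seed [F i] of the iterated minimum is itself one of the values of F. *)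
Definition min_modes (i : 'I_m) (F : 'I_m -> R) : R :=
  \big[Num.min/F i]_(j < m) F j.

Definition argmin_modes (F : 'I_m -> R) : set 'I_m :=
  [set j | forall k, F j <= F k].

(* \hat V_t^i when t = T - n *)
Fixpoint Vhat_steps (n t : nat) (i : 'I_m) : Omega -> R :=
  if n is n'.+1 then
    fun w => min_modes i (fun j => rho t (gtilde i j t \+ Vhat_steps n' t.+1 j) w)
  else fun w => min_modes i (fun j => rho t (gtilde i j t) w).

Definition Vhat (t : nat) (i : 'I_m) : Omega -> R := Vhat_steps (T - t) t i.

Definition one_step_risk (s : nat) (k j : 'I_m) : Omega -> R :=
  if (s < T)%N then rho s (gtilde k j s \+ Vhat s.+1 j) else rho T (gtilde k j T).

(* Evaluation of a family of random variables at the random mode eta *)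
Definition at_mode (eta : Omega -> 'I_m) (X : 'I_m -> Omega -> R) : Omega -> R :=
  fun w => \sum_(k < m) \1_(eta @^-1` [set k]) w * X k w.

(* xi_s belongs to the argmin for every s = t, ..., T; recall the index shift. *)
Definition follows_argmin (t : nat) (xi : nat -> Omega -> 'I_m) : Prop :=
  forall s, (t <= s <= T)%N -> \forall w \ae P,
    argmin_modes (fun j => at_mode (xi s) (fun k => one_step_risk s k j) w)
      (xi s.+1 w).

End OptimalSwitching.

(* Main.v *)
(* Monotonicity and translation invariance make each rho_s local: on an event
   of G_s, rho_s(W) depends only on W there. Hence a G_s-measurable pair of modes
   (xi_{s-1}, xi_s) can be frozen inside rho_s, and by backward induction the
   risk of any strategy from time s on dominates \hat V_s at the mode xi_{s-1},
   with equality when the strategy follows the minimisers. Such a strategy exists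
   by measurable selection, so \hat V_t is attained in the family and is therefore
   its essential infimum. *)
Require Import Defs.
From mathcomp Require Import all_boot all_order all_algebra.
From mathcomp Require Import all_classical all_reals all_analysis measurable_realfun ess_sup_inf.
Set Implicit Arguments.
Unset Strict Implicit.

Import Order.TTheory GRing.Theory Num.Theory.
Import numFieldNormedType.Exports.
Local Open Scope classical_set_scope.
Local Open Scope ring_scope.

(** * Measurability of maps with values in a finite set *)

Section FiniteValued.
Context {d : measure_display} {T : measurableType d}.

Lemma measurable_fiber_comp {A B : finType} (h : A -> B) (f : T -> A) :
  (forall a, measurable (f @^-1` [set a])) ->
  forall b, measurable ((h \o f) @^-1` [set b]).
Proof.
move=> mf b.
rewrite (_ : _ @^-1` _ = \bigcup_(a in [set a | h a = b]) (f @^-1` [set a])).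
  by apply: fin_bigcup_measurable.
apply/seteqP; split=> [w /= hb|w [a /= <- ->]//].
by exists (f w).
Qed.

(** A fibre of a finite table of Booleans is a finite intersection of events, one per entry; the
    table of comparisons behind [argmin_mode] is of this kind. *)
Lemma measurable_fiber_ffun {A : finType} (p : A -> T -> bool) :
  (forall a, measurable_fun setT (p a)) ->
  forall b : {ffun A -> bool},
    measurable ((fun w => [ffun a => p a w]) @^-1` [set b]).
Proof.
move=> mp b.
rewrite (_ : _ @^-1` _ = \bigcap_(a in setT) (p a @^-1` [set b a])).
  apply: fin_bigcap_measurable => // a _.
  by rewrite -[X in measurable X]setTI; exact: mp.
apply/seteqP; split=> [w /= <- a _ /=|w /= pb]; first by rewrite ffunE.
by apply/ffunP => a; rewrite ffunE; exact: pb.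
Qed.

(** Splitting along the finitely many values of [f] freezes the random index. This is what lets the
    next mode depend measurably on the current one. *)
Lemma measurable_fiber_random {A B : finType} (f : T -> A) (h : A -> T -> B) :
  (forall a, measurable (f @^-1` [set a])) ->
  (forall a b, measurable (h a @^-1` [set b])) ->
  forall b, measurable ((fun w => h (f w) w) @^-1` [set b]).
Proof.
move=> mf mh b.
rewrite (_ : _ @^-1` _ =
    \bigcup_(a in setT) (f @^-1` [set a] `&` h a @^-1` [set b])).
  by apply: fin_bigcup_measurable => // a _; exact: measurableI.
apply/seteqP; split=> [w /= hb|w [a _ /= [-> ->]]//].
by exists (f w).
Qed.

Lemma measurable_fun_random d' (S : measurableType d') {A : finType}
    (f : T -> A) (X : A -> T -> S) :
  (forall a, measurable (f @^-1` [set a])) ->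
  (forall a, measurable_fun setT (X a)) ->
  measurable_fun setT (fun w => X (f w) w).
Proof.
move=> mf mX _ B mB; rewrite setTI.
rewrite (_ : _ @^-1` _ =
    \bigcup_(a in setT) (f @^-1` [set a] `&` X a @^-1` B)).
  apply: fin_bigcup_measurable => // a _; apply: measurableI => //.
  by rewrite -[X in measurable X]setTI; exact: mX.
apply/seteqP; split=> [w /= hb|w [a _ /= [<-]]//].
by exists (f w).
Qed.

End FiniteValued.

(** * Measurable selection of a minimising mode *)

Section Argmin.
Context {R : realType} {m : nat}.
Implicit Types (i j : 'I_m) (F : 'I_m -> R).

(* The selection is a function of finitely many comparisons, so the event that
   it takes a given value is measurable. *)
Definition pick_least i (b : {ffun 'I_m * 'I_m -> bool}) : 'I_m :=
  odflt i [pick j | [forall k, b (j, k)]].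

Definition argmin_mode i F : 'I_m :=
  pick_least i [ffun p : 'I_m * 'I_m => F p.1 <= F p.2].

Lemma argmin_modeP i F : argmin_modes F (argmin_mode i F).
Proof.
rewrite /argmin_mode /pick_least; case: pickP => /= [j /forallP H k|].
  by have := H k; rewrite ffunE.
(* The default value of [pick_least] is never reached: the modes form a finite set containing [i],
   so a minimiser exists and the search cannot fail. *)
case: (@Order.TotalTheory.arg_minP _ _ _ i xpredT F) => // j _ Fj /(_ j).
by move/negbT/forallP; case=> k; rewrite ffunE /=; exact: Fj.
Qed.

Lemma min_modes_argmin i F j : argmin_modes F j -> min_modes i F = F j.
Proof.
move=> Fj; apply/eqP; rewrite eq_le; apply/andP; split; first exact: bigmin_le.
by apply: le_bigmin => [|k _]; exact: Fj.
Qed.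

Lemma min_modes_le i F j : min_modes i F <= F j.
Proof. exact: bigmin_le. Qed.

Lemma measurable_argmin_mode {d : measure_display} {T : measurableType d} i
    (F : 'I_m -> T -> R) :
  (forall j, measurable_fun setT (F j)) ->
  forall k, measurable ((fun w => argmin_mode i (F ^~ w)) @^-1` [set k]).
Proof.
move=> mF; apply: (measurable_fiber_comp (pick_least i)).
apply: (measurable_fiber_ffun (p := fun p w => F p.1 w <= F p.2 w)) => p.
exact: measurable_fun_ler.
Qed.

End Argmin.

(** * Essentially bounded variables and attained essential infima *)

Section Linfty.
Context {R : realType} {d : measure_display} {Omega : measurableType d}.
Variable P : probability Omega R.
Implicit Types X Y : Omega -> R.

Lemma LinftyP X : Linfty P X <->
  measurable_fun setT X /\ exists M : R, \forall w \ae P, `|X w| <= M.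
Proof.
have E : finite_norm P +oo%E X <-> exists M : R, \forall w \ae P, `|X w| <= M.
  (* Positive total mass selects the branch of [Lnorm] in which the norm at infinity is the
     essential supremum. *)
  have P0 : (0 < P [set: Omega])%E by rewrite probability_setT.
  rewrite /finite_norm unlock /Lnorm P0; split.
    move=> h; have [r hr] : exists r : R, (ess_sup P (abse \o (EFin \o X)) <= r%:E)%E.
      by case: (ess_sup _ _) h => [r _| //|_]; [exists r|exists 0; exact: leNye].
    by exists r; move/ess_supP: hr; apply: filterS => w.
  move=> [M hM]; apply: le_lt_trans (ltry M).
  by apply/ess_supP; apply: filterS hM => w; rewrite lee_fin.
rewrite /Linfty /= /Lfun; split.
  by move=> /andP[]; rewrite inE /= => mX; rewrite inE /= => /E.
by move=> [mX /E nX]; apply/andP; rewrite !inE.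
Qed.

Lemma LinftyD X Y : Linfty P X -> Linfty P Y -> Linfty P (X \+ Y).
Proof.
move=> /LinftyP[mX [M XM]] /LinftyP[mY [N YN]]; apply/LinftyP; split.
  exact: measurable_funD.
exists (M + N); apply: filterS2 XM YN => w XM YN /=.
by apply: le_trans (ler_normD _ _) _; exact: lerD.
Qed.

Lemma Linfty_random {A : finType} (f : Omega -> A) (X : A -> Omega -> R) :
  (forall a, measurable (f @^-1` [set a])) -> (forall a, Linfty P (X a)) ->
  Linfty P (fun w => X (f w) w).
Proof.
move=> mf LX; apply/LinftyP; split.
  by apply: measurable_fun_random => // a; have /LinftyP[] := LX a.
have /choice[M XM] : forall a, exists M : R, \forall w \ae P, `|X a w| <= M.
  by move=> a; have /LinftyP[] := LX a.
(* This sum dominates each [M a], hence the bound at the random index, whatever value [f] takes. *)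
exists (\sum_a `|M a|).
have H : \forall w \ae P, forall a, `|X a w| <= M a by apply: filter_forall.
apply: filterS H => w XMw.
apply: le_trans (XMw _) _; apply: le_trans (ler_norm _) _.
by rewrite (bigD1 (f w)) //= lerDl sumr_ge0.
Qed.

Lemma Linfty_indic M (A : set Omega) : measurable A ->
  Linfty P (fun w => M * \1_A w).
Proof.
move=> mA; apply/LinftyP; split.
  by apply: measurable_funM => //; exact: measurable_indic.
exists `|M|; apply: aeW => w; rewrite normrM ler_piMr // indicE.
by case: (_ \in _); rewrite /= ?normr1 ?normr0.
Qed.

(** A measurable lower bound that agrees a.s. with a member of the family is itself a version of the
    essential infimum, and any two versions bound each other a.s. *)
Lemma ess_infimum_attained (F : set (Omega -> R)) X X' :
  (forall Y, F Y -> \forall w \ae P, X w <= Y w) ->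
  F X' -> X = X' %[ae P] -> measurable_fun setT X ->
  EFin \o X = ess_infimum P F %[ae P].
Proof.
move=> XF FX' XX' mX.
have inf : is_ess_infimum P F (EFin \o X).
  split=> [|Y FY|Z mZ ZF]; first exact/measurable_EFinP.
  - by apply: filterS (XF _ FY) => w; rewrite /= lee_fin.
  - by apply: filterS2 (ZF _ FX') XX' => w ZX' /(_ I) /= ->.
(* A version exists, so [xget] returns one instead of its default. *)
have [mI IF Imax] : is_ess_infimum P F (ess_infimum P F).
  by apply: (xgetPex (cst +oo%E)); exists (EFin \o X).
case: inf => mEX EXF EXmax.
apply: filterS2 (Imax _ mEX EXF) (EXmax _ mI IF) => w le1 le2 _.
by apply/eqP; rewrite eq_le le1 le2.
Qed.

End Linfty.

(** * Locality of conditional risk mappings *)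

Section RiskMapping.
Context {R : realType} {d : measure_display} {Omega : measurableType d}.
Context (P : probability Omega R) (T : nat) (G : nat -> set (set Omega)).
Context (rho : nat -> (Omega -> R) -> Omega -> R).
Context (hG : is_filtration T G) (hrho : is_cond_risk_mapping P T G rho).

(** Generating from [G t] adds nothing, as it is already a sigma-algebra. Results on measurable
    types thus apply to [G t] itself. *)
Lemma filtration_measurable t (A : set Omega) : (t <= T)%N ->
  (@measurable _ (g_sigma_algebraType (G t)) A) = G t A.
Proof.
by case: hG => sG _ _ tT; rewrite measurable_g_measurableTypeE //; exact: sG.
Qed.

Lemma Linfty_crm t W : (t <= T)%N -> Linfty P W -> Linfty P (rho t W).
Proof. by move=> tT LW; case: (crm_range hrho tT LW). Qed.

(* Off A, W exceeds Z by at most a constant M, so W <= Z + M 1_{~A}, and the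
   G_t-measurable term M 1_{~A} can be taken out of rho_t and vanishes on A. *)
Lemma crm_local_le t (A : set Omega) W Z : (t <= T)%N -> G t A ->
  Linfty P W -> Linfty P Z -> (\forall w \ae P, A w -> W w <= Z w) ->
  \forall w \ae P, A w -> rho t W w <= rho t Z w.
Proof.
move=> tT GA LW LZ WZ.
have mA : measurable A by case: hG => _ GM _; exact: GM GA.
have [_ [M WM]] := (LinftyP P W).1 LW.
have [_ [N ZN]] := (LinftyP P Z).1 LZ.
pose D := fun w => (M + N) * \1_(~` A) w.
have LD : Linfty P D by apply: Linfty_indic; exact: measurableC.
have LGD : Linfty_sub P (G t) D.
  split=> //; apply: measurable_funM => //; apply: measurable_indic.
  by apply: measurableC; rewrite filtration_measurable.
have LDZ : Linfty P (D \+ Z) by exact: LinftyD.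
have WDZ : \forall w \ae P, W w <= (D \+ Z) w.
  apply: filterS3 WM ZN WZ => w WM ZN WZ; rewrite /D /= indicE in_setC.
  have [/set_mem Aw|_] /= := boolP (w \in A); first by rewrite mulr0 add0r WZ.
  rewrite mulr1; move: WM ZN; rewrite !ler_norml => /andP[_ WM] /andP[ZN _].
  by apply: le_trans WM _; rewrite -addrA lerDl -lerBlDl sub0r.
have rWDZ := crm_monotone hrho tT LW LDZ WDZ.
have rDZ := crm_translation hrho tT LGD LZ.
apply: filterS2 rWDZ rDZ => w rWDZ /(_ I) rDZ Aw; apply: le_trans rWDZ _.
by rewrite rDZ /D /= indicE in_setC mem_set //= mulr0 add0r.
Qed.

Lemma crm_local t (A : set Omega) W Z : (t <= T)%N -> G t A ->
  Linfty P W -> Linfty P Z -> (\forall w \ae P, A w -> W w = Z w) ->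
  \forall w \ae P, A w -> rho t W w = rho t Z w.
Proof.
move=> tT GA LW LZ WZ.
have h1 : \forall w \ae P, A w -> rho t W w <= rho t Z w.
  by apply: crm_local_le => //; apply: filterS WZ => w WZ Aw; rewrite WZ.
have h2 : \forall w \ae P, A w -> rho t Z w <= rho t W w.
  by apply: crm_local_le => //; apply: filterS WZ => w WZ Aw; rewrite WZ.
apply: filterS2 h1 h2 => w h1 h2 Aw.
by apply/eqP; rewrite eq_le h1 ?h2.
Qed.

(** On each event where [f] equals [a], which lies in [G t], the argument coincides with [Y a], so
    locality applies; the finitely many exceptional null sets are then merged. *)
Lemma crm_random {A : finType} t (f : Omega -> A) (Y : A -> Omega -> R) :
  (t <= T)%N -> (forall a, G t (f @^-1` [set a])) ->
  (forall a, Linfty P (Y a)) ->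
  \forall w \ae P, rho t (fun w' => Y (f w') w') w = rho t (Y (f w)) w.
Proof.
move=> tT Gf LY.
have Lf : Linfty P (fun w' => Y (f w') w').
  by apply: Linfty_random => // a; case: hG => _ GM _; apply: GM (Gf a).
have H : \forall w \ae P, forall a, f w = a ->
    rho t (fun w' => Y (f w') w') w = rho t (Y a) w.
  apply: filter_forall => a.
  by apply: (crm_local (A := f @^-1` [set a])) => //; apply: aeW => w /= ->.
by apply: filterS H => w; exact.
Qed.

End RiskMapping.

(** At the horizon the induction hypothesis is vacuous, so a single step covers both the terminal
    and the intermediate times. *)
Lemma backward_induction (T : nat) (Q : nat -> Prop) :
  (forall s, (s <= T)%N -> ((s < T)%N -> Q s.+1) -> Q s) ->
  forall s, (s <= T)%N -> Q s.
Proof.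
move=> step s sT; have [n] := ubnP (T - s); elim: n s sT => // n IH s sT.
rewrite ltnS => sn; apply: step => // s_lt; apply: IH => //.
by rewrite subnS prednK // subn_gt0.
Qed.

(** * The backward recursion and its one-step costs *)

Section OptimalSwitching.
Context {R : realType} {d : measure_display} {Omega : measurableType d}.
Context (P : probability Omega R) (T : nat) (G : nat -> set (set Omega)).
Context (rho : nat -> (Omega -> R) -> Omega -> R) (m : nat).
Context (g : 'I_m -> nat -> Omega -> R) (c : 'I_m -> 'I_m -> nat -> Omega -> R).
Context (hG : is_filtration T G) (hrho : is_cond_risk_mapping P T G rho).
Context (hg : forall i t, (t <= T)%N -> Linfty P (g i t)).
Context (hc : forall i j t, (t <= T)%N -> Linfty P (c i j t)).

Local Notation Vhat := (Vhat T rho g c).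
Local Notation one_step_risk := (one_step_risk T rho g c).
Local Notation gtilde := (gtilde g c).
Local Notation strategy_risk := (strategy_risk T rho g c).
Local Notation switching_cost := (switching_cost g c).

Lemma at_modeE (eta : Omega -> 'I_m) (X : 'I_m -> Omega -> R) w :
  at_mode eta X w = X (eta w) w.
Proof.
rewrite /at_mode (bigD1 (eta w)) //= big1 => [|k].
  by rewrite indicE mem_set // mul1r addr0.
by rewrite eq_sym => /eqP ne; rewrite indicE memNset // mul0r.
Qed.

Lemma VhatE s i w : (s <= T)%N ->
  Vhat s i w = min_modes i (fun j => one_step_risk s i j w).
Proof.
rewrite leq_eqVlt => /predU1P[->|sT]; rewrite /Defs.Vhat /Defs.one_step_risk.
  by rewrite ltnn subnn.
by rewrite sT -(subnSK sT).
Qed.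

Lemma strategy_riskE s xi : (s <= T)%N ->
  strategy_risk s xi = if (s < T)%N
    then rho s (switching_cost xi s \+ strategy_risk s.+1 xi)
    else rho s (switching_cost xi s).
Proof.
rewrite leq_eqVlt => /predU1P[->|sT]; rewrite /Defs.strategy_risk /agg_risk.
  by rewrite ltnn subnn.
by rewrite sT -(subnSK sT).
Qed.

Lemma Linfty_gtilde i j s : (s <= T)%N -> Linfty P (gtilde i j s).
Proof. by move=> sT; apply: LinftyD; [exact: hg|exact: hc]. Qed.

(** Isolating the argument of the risk mapping lets terminal and intermediate times be frozen by the
    same locality argument. *)
Definition one_step_cost s k j : Omega -> R :=
  if (s < T)%N then gtilde k j s \+ Vhat s.+1 j else gtilde k j s.

Lemma one_step_riskE s k j : (s <= T)%N ->
  one_step_risk s k j = rho s (one_step_cost s k j).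
Proof.
rewrite leq_eqVlt /Defs.one_step_risk /one_step_cost => /predU1P[->|sT].
  by rewrite ltnn.
by rewrite sT.
Qed.

Lemma Linfty_one_step_cost s k j : (s <= T)%N ->
  ((s < T)%N -> Linfty P (Vhat s.+1 j)) -> Linfty P (one_step_cost s k j).
Proof.
move=> sT LV; rewrite /one_step_cost; case: ifPn => [/LV {}LV|_].
  by apply: LinftyD => //; exact: Linfty_gtilde.
exact: Linfty_gtilde.
Qed.

(** The minimum is rewritten as the one-step risk evaluated at a measurable minimiser, so that
    [Linfty_random] applies. *)
Lemma Linfty_Vhat s : (s <= T)%N -> forall i, Linfty P (Vhat s i).
Proof.
move: s; apply: backward_induction => s sT IH i.
have Lr j : Linfty P (one_step_risk s i j).
  rewrite one_step_riskE //; apply: (Linfty_crm hrho) => //.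
  by apply: Linfty_one_step_cost => // /IH.
rewrite (_ : Vhat s i = fun w =>
    one_step_risk s i (argmin_mode i (fun j => one_step_risk s i j w)) w).
  apply: Linfty_random => //; apply: measurable_argmin_mode => j.
  by case: ((LinftyP P _).1 (Lr j)).
apply/funext => w; rewrite VhatE //.
exact/min_modes_argmin/argmin_modeP.
Qed.

Lemma one_step_risk_range s k j : (s <= T)%N ->
  Linfty_sub P (G s) (one_step_risk s k j).
Proof.
move=> sT; rewrite one_step_riskE //; apply: (crm_range hrho) => //.
by apply: Linfty_one_step_cost => // sT'; exact: Linfty_Vhat.
Qed.

Lemma filtration_cst s (i k : 'I_m) : (s <= T)%N ->
  G s ((cst i : Omega -> 'I_m) @^-1` [set k]).
Proof.
move=> sT; rewrite preimage_cst -(filtration_measurable hG) //.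
by case: ifP => _; [exact: measurableT|exact: measurable0].
Qed.

(** * Comparison of the risk of a strategy with the recursion *)

Section Strategy.
Context {xi : nat -> Omega -> 'I_m} (hxi : is_strategy T G xi).

(** By the index shift, [xi s] is chosen at the preceding time, hence known at time [s]; for [s = 0]
    it is the deterministic initial mode. *)
Lemma strategy_predictable s k : (s <= T)%N -> G s (xi s @^-1` [set k]).
Proof.
case: hxi => -[i0 xi0] xiG; case: s => [|s] sT; last first.
  by case: hG => _ _; apply; [|exact: xiG (ltnW sT) k]; rewrite leqnSn.
by rewrite xi0; exact: filtration_cst.
Qed.

Lemma strategy_pair s p : (s <= T)%N ->
  G s ((fun w => (xi s w, xi s.+1 w)) @^-1` [set p]).
Proof.
move=> sT; case: p => k j.
rewrite (_ : _ @^-1` _ = xi s @^-1` [set k] `&` xi s.+1 @^-1` [set j]).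
  rewrite -(filtration_measurable hG) //.
  by apply: measurableI; rewrite (filtration_measurable hG) //;
    [exact: strategy_predictable|case: hxi => _; exact].
by apply/seteqP; split=> w /= [] -> ->.
Qed.

Lemma measurable_strategy_pair s p : (s <= T)%N ->
  measurable ((fun w => (xi s w, xi s.+1 w)) @^-1` [set p]).
Proof. by move=> sT; case: hG => _ GM _; apply: GM (strategy_pair p sT). Qed.

Lemma Linfty_switching_cost s : (s <= T)%N -> Linfty P (switching_cost xi s).
Proof.
move=> sT.
apply: (Linfty_random (f := fun w => (xi s w, xi s.+1 w))
  (X := fun p => gtilde p.1 p.2 s)) => p; first exact: measurable_strategy_pair.
exact: Linfty_gtilde.
Qed.

Lemma Linfty_strategy_risk s : (s <= T)%N -> Linfty P (strategy_risk s xi).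
Proof.
move: s; apply: backward_induction => s sT IH; rewrite strategy_riskE //.
case: ifPn => [/IH LU|_]; apply: (Linfty_crm hrho) => //;
  last exact: Linfty_switching_cost.
by apply: LinftyD => //; exact: Linfty_switching_cost.
Qed.

(** An intermediate quantity: the strategy is followed at time [s], but the continuation is the
    recursive value [Vhat] instead of the strategy's own later risk. *)
Definition realised_cost s : Omega -> R :=
  fun w => one_step_cost s (xi s w) (xi s.+1 w) w.

Lemma Linfty_realised_cost s : (s <= T)%N -> Linfty P (realised_cost s).
Proof.
move=> sT.
apply: (Linfty_random (f := fun w => (xi s w, xi s.+1 w))
  (X := fun p => one_step_cost s p.1 p.2)) => p; first exact: measurable_strategy_pair.
by apply: Linfty_one_step_cost => // sT'; exact: Linfty_Vhat.
Qed.

Lemma realised_one_step_risk s : (s <= T)%N ->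
  \forall w \ae P,
    rho s (realised_cost s) w = one_step_risk s (xi s w) (xi s.+1 w) w.
Proof.
move=> sT.
have LY p : Linfty P (one_step_cost s p.1 p.2).
  by apply: Linfty_one_step_cost => // sT'; exact: Linfty_Vhat.
have := crm_random hG hrho sT (fun p => strategy_pair p sT) LY.
by apply: filterS => w ->; rewrite one_step_riskE.
Qed.

Lemma strategy_risk_ge s : (s <= T)%N ->
  \forall w \ae P, Vhat s (xi s w) w <= strategy_risk s xi w.
Proof.
move: s; apply: backward_induction => s sT IH.
(* By induction the continuation risk dominates [Vhat] at the new mode, and monotonicity carries
   this through [rho s]. At the horizon both sides are equal. *)
have le_risk : \forall w \ae P, rho s (realised_cost s) w <= strategy_risk s xi w.
  rewrite strategy_riskE // /realised_cost /one_step_cost; case: ifPn => [sT'|_].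
    apply: (crm_monotone hrho) => //.
    - by have := Linfty_realised_cost sT; rewrite /realised_cost /one_step_cost sT'.
    - by apply: LinftyD; [exact: Linfty_switching_cost|exact: Linfty_strategy_risk].
    - by apply: filterS (IH sT') => w; rewrite /= lerD2l.
  exact: aeW.
apply: filterS2 le_risk (realised_one_step_risk sT) => w.
by move=> h1 h2; apply: le_trans h1; rewrite h2 VhatE //; exact: min_modes_le.
Qed.

Lemma strategy_risk_argmin t : follows_argmin P T rho g c t xi ->
  forall s, (s <= T)%N -> (t <= s)%N ->
  \forall w \ae P, strategy_risk s xi w = Vhat s (xi s w) w.
Proof.
move=> hmin; apply: backward_induction => s sT IH ts.
have eq_risk : \forall w \ae P, strategy_risk s xi w = rho s (realised_cost s) w.
  have LX := Linfty_realised_cost sT.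
  rewrite strategy_riskE //; move: LX.
  rewrite /realised_cost /one_step_cost; case: ifPn => [sT'|_] LX;
    last exact: aeW.
  have LU : Linfty P (switching_cost xi s \+ strategy_risk s.+1 xi).
    by apply: LinftyD; [exact: Linfty_switching_cost|exact: Linfty_strategy_risk].
  have E := IH sT' (leqW ts).
  (* Locality on the whole space says that [rho s] respects a.s. equality. *)
  have GT : G s setT by rewrite -(filtration_measurable hG) //; exact: measurableT.
  have := crm_local hG hrho sT GT LU LX.
  move=> H; apply: filterS (H _) => [w|]; first by exact.
  by apply: filterS E => w E _; rewrite /= E.
have tsT : (t <= s <= T)%N by rewrite ts.
apply: filterS3 eq_risk (realised_one_step_risk sT) (hmin _ tsT) => w -> ->.
rewrite VhatE // => Hmin; apply/esym/min_modes_argmin => k.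
by have := Hmin k; rewrite !at_modeE.
Qed.

End Strategy.

(** * Construction of an optimal strategy *)

Fixpoint argmin_strategy (t : nat) (i : 'I_m) (s : nat) (w : Omega) : 'I_m :=
  if s is s'.+1 then
    if (s' < t)%N then i
    else let k := argmin_strategy t i s' w in
         argmin_mode i (fun j => one_step_risk s' k j w)
  else i.

(** Index [t] is the mode held just before time [t]. Holding [i] at all earlier indices too keeps
    the initial mode deterministic, as [is_strategy] demands. *)
Lemma argmin_strategy_start t i s : (s <= t)%N -> argmin_strategy t i s = cst i.
Proof. by case: s => [|s] st; apply/funext => w //=; rewrite st. Qed.

Lemma argmin_strategy_step t i s : (s <= T)%N ->
  (forall k, G s (argmin_strategy t i s @^-1` [set k])) ->
  forall k, G s (argmin_strategy t i s.+1 @^-1` [set k]).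
Proof.
move=> sT Gs k; have [st|ts] := ltnP s t.
  by rewrite argmin_strategy_start //; exact: filtration_cst.
rewrite (_ : argmin_strategy t i s.+1 = fun w =>
  argmin_mode i (fun j => one_step_risk s (argmin_strategy t i s w) j w)).
  rewrite -(filtration_measurable hG) //.
  (* The selection is measured on the space carrying [G s] only, which turns measurability into
     adaptedness. *)
  apply: (measurable_fiber_random (T := g_sigma_algebraType (G s))
    (f := argmin_strategy t i s)
    (h := fun k w => argmin_mode i (fun j => one_step_risk s k j w))) => [k'|k'].
    by rewrite (filtration_measurable hG).
  apply: measurable_argmin_mode => j.
  by case: (one_step_risk_range k' j sT).
by apply/funext => w; rewrite [LHS]/= ltnNge ts.
Qed.

Lemma argmin_strategyP t i : strategies_from P T G t i (argmin_strategy t i).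
Proof.
split; last by rewrite argmin_strategy_start //; apply: aeW.
split=> [|s]; first by exists i.
elim: s => [|s IH] sT; apply: argmin_strategy_step => //.
  by move=> k; exact: filtration_cst.
(* By induction the mode of index [s.+1] is known at time [s]; the step at time [s.+1] needs it in
   the larger sigma-algebra. *)
move=> k; case: hG => _ _ Gle.
by apply: (Gle s); [rewrite leqnSn|exact: IH (ltnW sT) k].
Qed.

Lemma argmin_strategy_follows t i :
  follows_argmin P T rho g c t (argmin_strategy t i).
Proof.
move=> s /andP[ts sT]; apply: aeW => w k; rewrite !at_modeE /= ltnNge ts /=.
exact: (argmin_modeP i
  (fun j => one_step_risk s (argmin_strategy t i s w) j w)).
Qed.

Lemma Vhat_value t i : (t <= T)%N ->
  EFin \o Vhat t i = value P T G rho g c t i %[ae P].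
Proof.
move=> tT; have [hs hi] := argmin_strategyP t i.
apply: (ess_infimum_attained (X' := strategy_risk t (argmin_strategy t i))).
- move=> _ [xi [xis xii] <-].
  by apply: filterS2 (strategy_risk_ge xis tT) xii => w + /(_ I) xiw; rewrite xiw.
- by exists (argmin_strategy t i).
- have := strategy_risk_argmin hs (@argmin_strategy_follows t i) tT (leqnn t).
  by apply: filterS => w ->; rewrite argmin_strategy_start.
- by case: ((LinftyP P _).1 (Linfty_Vhat tT i)).
Qed.

End OptimalSwitching.

Theorem theorem2p3 (R : realType) (d : measure_display) (Omega : measurableType d)
    (P : probability Omega R) (T : nat) (G : nat -> set (set Omega))
    (rho : nat -> (Omega -> R) -> Omega -> R) (m : nat)
    (g : 'I_m -> nat -> Omega -> R) (c : 'I_m -> 'I_m -> nat -> Omega -> R)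
    (hG : is_filtration T G)
    (hrho : is_cond_risk_mapping P T G rho)
    (hg : forall i t, (t <= T)%N -> Linfty P (g i t))
    (hc : forall i j t, (t <= T)%N -> Linfty P (c i j t))
    (hc0 : forall i t, (t <= T)%N -> c i i t = cst 0 %[ae P]) :
  (forall i t, (t <= T)%N ->
     EFin \o Vhat T rho g c t i = value P T G rho g c t i %[ae P]) /\
  (forall i t, (t <= T)%N ->
     (exists xi, strategies_from P T G t i xi /\ follows_argmin P T rho g c t xi) /\
     (forall xi, strategies_from P T G t i xi -> follows_argmin P T rho g c t xi ->
        EFin \o strategy_risk T rho g c t xi = value P T G rho g c t i %[ae P])).
Proof.
split=> [i t tT|i t tT].
  exact (Vhat_value hG hrho hg hc i tT).
split=> [|xi [xis xii] xmin].
  exists (argmin_strategy T rho g c t i).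
  split; first exact: argmin_strategyP hG hrho hg hc t i.
  exact: argmin_strategy_follows.
(* Every strategy following the minimisers has risk [Vhat] at its starting mode, which is a.s. [i];
   the choice among tied minimisers does not matter. *)
apply: filterS3 (Vhat_value hG hrho hg hc i tT) xii
  (strategy_risk_argmin hG hrho hg hc xis xmin tT (leqnn t)).
by move=> w /(_ I) <- /(_ I) xiw risk _; rewrite /= risk xiw.
Qed.
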